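(* For each positive integer $r$, $D_r(x_1,\ldots,x_r)=\varphi_r(x_1,\ldots,x_r)$.
   Context: $D_r(x_1,\ldots,x_r)=\det(I-M_r)$, where $M_r=(m_{ij})$ is the $r\times r$ matrix with $m_{ij}=x_j$ if $i+j\ge r+1$ and $m_{ij}=0$ otherwise, and $I$ is the identity. An odd composition is a finite sequence of odd positive integers; $\mathrm{OC}_{\le r}$ is the set of odd compositions of integers in $\{0,\ldots,r\}$ (including the empty one); $\ell(\alpha)$ is the number of parts of $\alpha$. Let $\sigma_r$ be the permutation of $\{1,\ldots,r\}$ with $\sigma_r(i)=i/2$ for $i$ even and $\sigma_r(i)=r+(1-i)/2$ for $i$ odd. Define \[ \varphi_r(x_1,\ldots,x_r)=\sum_{\alpha\in\mathrm{OC}_{\le r}}(-1)^{\lfloor(\ell(\alpha)+1)/2\rfloor}\prod_{i=1}^{\ell(\alpha)}x_{\sigma_r(\alpha_1+\cdots+\alpha_i)}. \] *)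

(* Defs.v *)
From mathcomp Require Import all_boot all_order all_algebra zify.

Set Implicit Arguments.
Unset Strict Implicit.
Unset Printing Implicit Defensive.

Import GRing.Theory.
Local Open Scope ring_scope.

(* Indices are 1-based: a family x : nat -> R stands for (x 1, ..., x r), its
   other values are never used.  Matrix indices i, j : 'I_r are 0-based, hence
   the successors. *)

Definition Mr (R : comNzRingType) (r : nat) (x : nat -> R) : 'M[R]_r :=
  \matrix_(i < r, j < r) (if (r + 1 <= i.+1 + j.+1)%N then x j.+1 else 0).

Definition Dr (R : comNzRingType) (r : nat) (x : nat -> R) : R :=
  \det (1%:M - Mr r x).

Definition odd_composition (a : seq nat) : bool := all odd a.

(* A composition of an integer at most r has at most r parts, each at most r,
   so filtering the finite type {bseq r of 'I_r.+1} loses nothing: see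
   mem_OCle and uniq_OCle. *)
Definition OCle (r : nat) : seq (seq nat) :=
  [seq a <- [seq [seq val k | k <- s] | s : {bseq r of 'I_r.+1}]
     | odd_composition a & (sumn a <= r)%N].

(* For odd i this is r + (1 - i) / 2; the truncated subtraction is exact on
   1 <= i <= r. *)
Definition sigma (r i : nat) : nat :=
  if odd i then (r - i.-1./2)%N else i./2.

Definition phi (R : comNzRingType) (r : nat) (x : nat -> R) : R :=
  \sum_(a <- OCle r)
    (-1) ^+ ((size a).+1)./2 *
    \prod_(i < size a) x (sigma r (sumn (take i.+1 a))).

Lemma mem_OCle (r : nat) (a : seq nat) :
  (a \in OCle r) = odd_composition a && (sumn a <= r)%N.
Proof.
rewrite mem_filter andb_idr // => /andP[odd_a le_a].
have size_le : forall b, odd_composition b -> (size b <= sumn b)%N.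
  elim=> //= k b IH /andP[k_odd /IH le_b].
  by rewrite -add1n leq_add // odd_gt0.
have part_le : forall b k, k \in b -> (k <= sumn b)%N.
  elim=> //= m b IH k; rewrite inE => /orP[/eqP->|/IH le_k].
    exact: leq_addr.
  exact: leq_trans le_k (leq_addl _ _).
have sz : (size [seq (inord k : 'I_r.+1) | k <- a] <= r)%N.
  by rewrite size_map (leq_trans (size_le _ odd_a)).
apply/imageP; exists (Bseq sz) => //=.
rewrite -map_comp -[LHS]map_id; apply/eq_in_map => k ka /=.
by rewrite inordK // ltnS (leq_trans (part_le _ _ ka)).
Qed.

Lemma uniq_OCle (r : nat) : uniq (OCle r).
Proof.
apply: filter_uniq; rewrite map_inj_uniq ?enum_uniq // => s t /=.
by move/(inj_map val_inj)/val_inj.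
Qed.

Lemma sigma_bound (r i : nat) :
  (1 <= i <= r)%N -> (1 <= sigma r i <= r)%N.
Proof. rewrite /sigma; case: ifP; lia. Qed.

Lemma sigma_inj (r : nat) :
  {in [pred i | (1 <= i <= r)%N] &, injective (sigma r)}.
Proof. move=> i j /=; rewrite !inE /sigma; do 2 case: ifP; lia. Qed.

(* Main.v *)
Require Import Defs.
From mathcomp Require Import all_boot all_order all_algebra.
From mathcomp Require Import perm zify ring.

(** Listing the variables in the order y_k = x_{sigma_r(k)} conjugates I - M_r
    into the r-th leading principal submatrix of one infinite matrix that does
    not depend on r.  Consecutive rows of that matrix differ in only two of the
    first k columns, so its leading minors G_k, together with the minors H_k
    whose last column is replaced by the indicator of the odd indices, satisfy
    a two-term recursion.  Splitting the odd compositions of integers at most k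
    according to whether their sum is k gives a recursion for the even- and
    odd-length parts E_k, O_k of the sum phi, and the two recursions agree
    under G = E + O, with H = E for odd k and H = - O for even k. *)

Set Implicit Arguments.
Unset Strict Implicit.
Unset Printing Implicit Defensive.

Import GRing.Theory.
Local Open Scope ring_scope.

Section OddCompositionSums.

Variables (R : comNzRingType) (y : nat -> R).

Definition oc_term (a : seq nat) : R :=
  (-1) ^+ ((size a).+1)./2 * \prod_(i < size a) y (sumn (take i.+1 a)).

Definition oc_sum (n : nat) (b : bool) : R :=
  \sum_(a <- OCle n | odd (size a) == b) oc_term a.

Lemma odd_sumn_oc a : odd_composition a -> odd (sumn a) = odd (size a).
Proof. by elim: a => //= k a IH /andP[ok /IH]; rewrite oddD ok => ->. Qed.

Lemma OCle0 : perm_eq (OCle 0) [:: [::]].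
Proof.
apply: uniq_perm; rewrite ?uniq_OCle // => a; rewrite mem_OCle inE.
case: a => //= k a; apply/negP => /andP[/andP[ok _]].
by case: k ok.
Qed.

(** The new compositions have sum exactly [n.+1]; their last part is forced by the others, so
    deleting it loses nothing. *)
Lemma OCleS n :
  perm_eq (OCle n.+1)
    (OCle n ++ [seq rcons a (n.+1 - sumn a)%N |
                 a <- [seq a <- OCle n | odd (n.+1 - sumn a)%N]]).
Proof.
have rcons_inj_l (a c : seq nat) k l : rcons a k = rcons c l -> a = c.
  by move/rcons_inj => [].
apply: uniq_perm.
- exact: uniq_OCle.
- rewrite cat_uniq uniq_OCle map_inj_uniq; last by move=> a c /rcons_inj_l.
  rewrite (filter_uniq _ (uniq_OCle n)) andbT /=.
  apply/hasPn => c /mapP[a]; rewrite mem_filter mem_OCle => /and3P[_ _ le_a] ->.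
  by rewrite /= mem_OCle sumn_rcons subnKC ?ltnn ?andbF // leqW.
move=> a; rewrite mem_cat !mem_OCle [in LHS]leq_eqVlt ltnS andb_orr orbC.
congr (_ || _); apply/andP/mapP => [[oc_a /eqP sum_a]|[c]].
  case/lastP: a oc_a sum_a => // c k.
  rewrite /odd_composition all_rcons sumn_rcons => /andP[ok oc_c] sum_ck.
  have -> : k = (n.+1 - sumn c)%N by rewrite -sum_ck addKn.
  exists c => //; rewrite mem_filter mem_OCle -sum_ck addKn ok /=.
  rewrite /odd_composition oc_c /=.
  by move: (odd_gt0 ok) sum_ck; lia.
rewrite mem_filter mem_OCle => /and3P[ok oc_c le_c] ->.
rewrite /odd_composition all_rcons sumn_rcons ok; split=> //.
by rewrite subnKC // leqW.
Qed.

(** The exponent, half the length rounded up, grows only when a part is appended to an even number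
    of parts. *)
Lemma oc_term_rcons a k :
  oc_term (rcons a k) =
  (if odd (size a) then 1 else -1) * y (sumn a + k)%N * oc_term a.
Proof.
rewrite /oc_term size_rcons big_ord_recr /=.
rewrite take_oversize ?size_rcons // sumn_rcons.
under eq_bigr => i _ do rewrite -cats1 takel_cat //.
have -> : ((-1) ^+ (size a)./2.+1 : R) =
    (if odd (size a) then 1 else -1) * (-1) ^+ uphalf (size a).
  by rewrite uphalf_half exprD exprS; case: (odd _); rewrite /= ?expr1 ?expr0; ring.
by rewrite -!mulrA; congr (_ * _); rewrite [RHS]mulrCA; congr (_ * _); apply: mulrC.
Qed.

Lemma oc_sum0 b : oc_sum 0 b = (~~ b)%:R.
Proof.
rewrite /oc_sum (perm_big _ OCle0) /= big_cons big_nil /oc_term /= big_ord0.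
by case: b; rewrite /= ?expr0 ?mulr1 ?addr0.
Qed.

(** A sum of odd parts has the parity of their number, so the forced last part is odd for all
    compositions of a given length parity or for none. *)
Lemma oc_sumS n b :
  oc_sum n.+1 b = oc_sum n b +
  (if odd n == ~~ b then (if b then -1 else 1) * y n.+1 * oc_sum n (~~ b) else 0).
Proof.
rewrite /oc_sum (perm_big _ (OCleS n)) /= big_cat /=; congr (_ + _).
rewrite big_map big_filter_cond.
have odd_size_last a : a \in OCle n ->
    odd (n.+1 - sumn a)%N = (odd n == odd (size a)).
  rewrite mem_OCle => /andP[oc_a le_a].
  by rewrite oddB ?leqW //= (odd_sumn_oc oc_a); case: (odd n) (odd _) => [] [].
case: ifP => [/eqP nb|nb].
  rewrite big_distrr /= [LHS]big_seq_cond [RHS]big_seq_cond.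
  apply: eq_big => [a|a /and3P[a_in _]].
    case: (boolP (a \in OCle n)) => //= a_in.
    by rewrite (odd_size_last _ a_in) nb size_rcons /=; case: b (odd _) {nb} => [] [].
  rewrite size_rcons oc_term_rcons subnKC /=; last first.
    by move: a_in; rewrite mem_OCle => /andP[_ /leqW].
  by case: (odd _); case: b {nb}.
rewrite big_seq_cond big1 // => a /and3P[a_in].
rewrite (odd_size_last _ a_in) size_rcons /=.
by move: nb; case: b (odd n) (odd (size a)) => [] [] [].
Qed.

End OddCompositionSums.

Section ReorderedMinors.

Variables (R : comNzRingType) (y : nat -> R).

(* 0-based: [reord_adj i j] says that sigma_r(i+1) + sigma_r(j+1) >= r+1. *)
Definition reord_adj (i j : nat) : bool :=
  if odd i then (if odd j then false else (j < i)%N)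
  else (if odd j then (i < j)%N else true).

Definition reord_entry (i j : nat) : R :=
  (i == j)%:R - (if reord_adj i j then y j.+1 else 0).

Definition bordered_mx n (v : nat -> R) : 'M[R]_n.+1 :=
  \matrix_(i, j) if (j < n)%N then reord_entry i j else v i.

Definition reord_minor n : R := \det (\matrix_(i < n, j < n) reord_entry i j).

Lemma reord_minorS n :
  reord_minor n.+1 = \det (bordered_mx n (reord_entry^~ n)).
Proof.
congr (\det _); apply/matrixP => i j; rewrite !mxE.
by case: ltnP => // le_nj; have -> : nat_of_ord j = n by have := ltn_ord j; lia.
Qed.

(** On and below the diagonal [reord_adj i j] depends only on the parity of [j], so only the
    identity matrix contributes. *)
Lemma reord_entry_diff n j : (j <= n)%N ->
  reord_entry n.+1 j - reord_entry n j = - (j == n)%:R.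
Proof.
move=> le_jn; rewrite /reord_entry /reord_adj (eq_sym n j) /=.
have -> : (n.+1 == j) = false by lia.
have -> : (j < n.+1)%N = true by lia.
have -> : (n.+1 < j)%N = false by lia.
have -> : (n < j)%N = false by lia.
have -> : (j < n)%N = (j != n) by lia.
case: (eqVneq j n) => [->|_] /=; first by case: (odd n) => /=; ring.
by case: (odd n); case: (odd j) => /=; ring.
Qed.

Lemma det_bordered_mx0 v : \det (bordered_mx 0 v) = v 0%N.
Proof. by rewrite det_mx11 mxE. Qed.

(** Subtracting row [n] from the last row leaves -1 in column [n] and [v n.+1 - v n] in the last
    column; expansion along that row gives the two terms. *)
Lemma det_bordered_mxS n v :
  \det (bordered_mx n.+1 v) =
  (v n.+1 - v n) * reord_minor n.+1 + \det (bordered_mx n v).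
Proof.
pose A := bordered_mx n.+1 v.
pose pn : 'I_n.+2 := inord n.
have pnE : nat_of_ord pn = n by rewrite inordK.
(* The last row of [A] is the sum of those of [B] and [C], and [C] repeats row [n]. *)
pose B : 'M[R]_n.+2 :=
  \matrix_(i, j) if (i < n.+1)%N then A i j else A i j - A pn j.
pose C : 'M[R]_n.+2 := \matrix_(i, j) if (i < n.+1)%N then A i j else A pn j.
have detC : \det C = 0.
  apply: (determinant_alternate (i1 := pn) (i2 := ord_max)).
    by rewrite -val_eqE /= pnE; lia.
  by move=> j; rewrite !mxE /= pnE ltnSn ltnn.
have liftE (M : 'M[R]_n.+2) : (forall (i j : 'I_n.+2), (i < n.+1)%N -> M i j = A i j) ->
    row' ord_max M = row' ord_max A.
  by move=> eqM; apply/matrixP => i j; rewrite !mxE eqM ?mxE // lift_max.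
have -> : \det A = 1 * \det B + 1 * \det C.
  apply: (determinant_multilinear (i0 := ord_max)).
  - by apply/rowP => j; rewrite !mxE /= ltnn pnE; ring.
  - by apply/liftE => i j lt_i; rewrite !mxE lt_i.
  - by apply/liftE => i j lt_i; rewrite !mxE lt_i.
rewrite detC mulr0 addr0 mul1r (expand_det_row _ ord_max).
rewrite big_ord_recr big_ord_recr /= big1 ?add0r => [|i _]; last first.
  rewrite !mxE /= ltnn pnE ltnS (ltnW (ltn_ord i)) reord_entry_diff ?(ltnW (ltn_ord i)) //.
  by rewrite ltn_eqF // oppr0 mul0r.
rewrite !mxE /= !ltnn pnE ltnSn reord_entry_diff // eqxx /cofactor /=.
rewrite addrC; congr (_ * _ + _).
  rewrite -signr_odd oddD addbb expr0 mul1r; congr (\det _).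
  by apply/matrixP => i j; rewrite !mxE !lift_max !ltn_ord.
(* The odd cofactor sign cancels the entry -1; deleting column [n] moves [v] next to the leading
   block. *)
rewrite -signr_odd oddD /= addNb addbb expr1 mulrA mulrNN mulr1 mul1r.
congr (\det _); apply/matrixP => i j; rewrite !mxE !lift_max ltn_ord /= /bump.
case: (ltnP j n) => [lt_jn|le_nj]; first by rewrite add0n leqW.
by have -> : (true + j < n.+1)%N = false by lia.
Qed.

Lemma det_bordered_mxZ n c v w : (forall i, (i <= n)%N -> v i = c * w i) ->
  \det (bordered_mx n v) = c * \det (bordered_mx n w).
Proof.
move=> vE; rewrite (expand_det_col (bordered_mx n v) ord_max).
rewrite (expand_det_col (bordered_mx n w) ord_max) big_distrr /=.
apply: eq_bigr => i _; rewrite !mxE /= ltnn (vE _ (leq_ord i)) -mulrA.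
congr (_ * (_ * _)); congr (_ * \det _); apply/matrixP => k l.
by rewrite !mxE lift_max ltn_ord.
Qed.

Definition even_ind (i : nat) : R := (~~ odd i)%:R.

(* These are G_k and H_k for k = n+1; the odd k are the even n. *)
Lemma reord_minors_oc_sum n :
  reord_minor n.+1 = oc_sum y n.+1 false + oc_sum y n.+1 true /\
  \det (bordered_mx n even_ind) =
    if odd n then - oc_sum y n.+1 true else oc_sum y n.+1 false.
Proof.
elim: n => [|n [IHG IHH]].
  rewrite reord_minorS !det_bordered_mx0 !oc_sumS !oc_sum0 /=.
  by rewrite /reord_entry /even_ind /=; split; ring.
have GS : reord_minor n.+2 =
    (1 + (if odd n then - y n.+2 else y n.+2)) * reord_minor n.+1
    - y n.+2 * \det (bordered_mx n even_ind).
  rewrite [LHS]reord_minorS det_bordered_mxS; congr (_ * _ + _).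
    rewrite /reord_entry /reord_adj eqxx ltnn ltnSn (ltn_eqF (ltnSn n)) /=.
    have -> : (n.+1 < n)%N = false by lia.
    by case: (odd n) => /=; ring.
  (* Above the diagonal [reord_adj i n.+1] holds exactly for even [i], so this column is a multiple
     of [even_ind]. *)
  rewrite -mulNr; apply: det_bordered_mxZ => i le_in.
  rewrite /reord_entry /reord_adj /even_ind.
  have -> : (i == n.+1) = false by lia.
  have -> : (i < n.+1)%N = true by lia.
  have -> : (n.+1 < i)%N = false by lia.
  by case: (odd i); case: (odd n.+1) => /=; ring.
(* The jump of [even_ind] is 1 or -1, so H gains or loses G = E + O, which exchanges E and - O; the
   sum H then equals is the one this step leaves unchanged. *)
rewrite GS det_bordered_mxS IHG IHH ![oc_sum y n.+2 _]oc_sumS /even_ind /=.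
by case: (odd n) => /=; split; ring.
Qed.

End ReorderedMinors.

Lemma det_conj_perm (R : comNzRingType) n (A : 'M[R]_n) (s : 'S_n) :
  \det (\matrix_(i, j) A (s i) (s j)) = \det A.
Proof.
have -> : \matrix_(i, j) A (s i) (s j) = row_perm s (col_perm s A).
  by apply/matrixP => i j; rewrite !mxE.
rewrite row_permE col_permE !det_mulmx !det_perm odd_permV mulrCA -expr2.
by rewrite sqrr_sign mulr1.
Qed.

Lemma Dr_reord_minor (R : comNzRingType) r (x : nat -> R) :
  Dr r x = reord_minor (fun k => x (sigma r k)) r.
Proof.
have sb (i : 'I_r) : ((sigma r i.+1).-1 < r)%N.
  by have := @sigma_bound r i.+1; have := ltn_ord i; lia.
pose s i := Ordinal (sb i).
have sE i : (s i).+1 = sigma r i.+1.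
  by rewrite /=; have := @sigma_bound r i.+1; have := ltn_ord i; lia.
have s_inj : injective s.
  move=> i j /(congr1 (fun k : 'I_r => k.+1)); rewrite !sE => /sigma_inj.
  by rewrite !inE !ltn_ord => /(_ isT isT) [] /val_inj.
rewrite /Dr -(det_conj_perm _ (perm s_inj)); congr (\det _).
apply/matrixP => i j; rewrite !mxE !permE !sE (inj_eq s_inj) -val_eqE.
rewrite /reord_entry; congr (_%:R - (if _ then _ else _)).
rewrite /sigma /reord_adj /=; have := ltn_ord i; have := ltn_ord j.
(* Odd [i] gives the small value (i+1)/2, even [i] the large value r - i/2. Two small values add up
   to at most r, two large ones to at least r+1; a mixed pair compares the indices. *)
by case: (boolP (odd i)); case: (boolP (odd j)) => /=; lia.
Qed.

Lemma phi_oc_sum (R : comNzRingType) r (x : nat -> R) :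
  phi r x = oc_sum (fun k => x (sigma r k)) r false
          + oc_sum (fun k => x (sigma r k)) r true.
Proof.
rewrite /phi (bigID (fun a => odd (size a) == false)) /=; congr (_ + _).
by apply: eq_bigl => a; case: odd.
Qed.

Theorem theorem2p22 (R : comNzRingType) (r : nat) (x : nat -> R) (hr : (0 < r)%N) :
  Dr r x = phi r x.
Proof.
rewrite Dr_reord_minor phi_oc_sum.
by case: r hr => // n _; have [-> _] := reord_minors_oc_sum (fun k => x (sigma n.+1 k)) n.
Qed.
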